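(* Let $G$ be a finite simple graph and let $\mathcal{F}$ be a 2-colorable family of triangles in $G$. Then $\tau(\mathcal{F})\leq (1+\sqrt{3})\,\nu(\mathcal{F})$.
   Context: A triangle in a graph $G$ is a subgraph isomorphic to $K_3$ (three vertices, three edges); a family of triangles is a set of triangles in $G$, not necessarily all of them. A family $\mathcal{F}$ of triangles in $G$ is 2-colorable if the edges of $G$ can be colored red and blue so that each triangle in $\mathcal{F}$ has exactly two blue edges and one red edge. A family of triangles is independent if its triangles are pairwise edge-disjoint. $\nu(\mathcal{F})$ denotes the maximum size of an independent subfamily of $\mathcal{F}$. $\tau(\mathcal{F})$ denotes the minimum size of a transversal of $\mathcal{F}$, i.e. of a set of edges of $G$ that contains at least one edge of every triangle of $\mathcal{F}$. *)

(* Defs.v *)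
From mathcomp Require Import all_boot.
Set Implicit Arguments.
Unset Strict Implicit.
Unset Printing Implicit Defensive.

Record sgraph := SGraph {
  vertex :> finType;
  adj : rel vertex;
  adj_sym : symmetric adj;
  adj_irr : irreflexive adj }.

Section Triangles.
Variable G : sgraph.
Implicit Types (t : {set G}) (F H X : {set {set G}}).

(* An edge is the unordered pair of its end points; adj is irreflexive, so
   every edge has exactly two elements. *)
Definition edge_set : {set {set G}} :=
  [set [set p.1; p.2] | p : G * G & adj p.1 p.2].

(* In a simple graph a subgraph isomorphic to K_3 is determined by its three
   vertices, so triangles are represented by their vertex sets. *)
Definition is_triangle t : bool :=
  (#|t| == 3) && [forall x in t, forall y in t, (x != y) ==> adj x y].

Definition triangle_edges t : {set {set G}} := [set a in edge_set | a \subset t].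

Definition triangle_family F : bool := [forall t in F, is_triangle t].

(* The edges outside red are the blue ones. *)
Definition two_colorable F : Prop :=
  exists2 red : {set {set G}}, red \subset edge_set &
    forall t, t \in F ->
      #|triangle_edges t :&: (edge_set :\: red)| = 2 /\
      #|triangle_edges t :&: red| = 1.

Definition independent H : bool :=
  [forall s in H, forall t in H,
     (s != t) ==> [disjoint triangle_edges s & triangle_edges t]].

Definition nu F : nat := \max_(H : {set {set G}} | (H \subset F) && independent H) #|H|.

Definition transversal_of F X : bool :=
  (X \subset edge_set) &&
  [forall t in F, [exists a in X, a \in triangle_edges t]].

(* The seed edge_set of the minimization is a transversal of every family of
   triangles, see edge_set_transversal. *)
Definition tau F : nat :=
  #|[arg min_(X < edge_set | transversal_of F X) #|X| ]|.

Lemma edge_set_transversal F : triangle_family F -> transversal_of F edge_set.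
Proof.
move=> /forall_inP FT; apply/andP; split=> //; apply/forall_inP=> t tF.
have /andP[/eqP t3 /forall_inP tadj] := FT t tF.
have /card_gt1P[x [y [xt yt xy]]] : 1 < #|t| by rewrite t3.
have exy : [set x; y] \in edge_set.
  apply/imsetP; exists (x, y) => //; rewrite inE /=.
  by have /forall_inP/(_ y yt)/implyP/(_ xy) := tadj x xt.
apply/exists_inP; exists [set x; y] => //.
by rewrite inE exy; apply/subsetP=> z; rewrite !inE => /orP[]/eqP->.
Qed.

Lemma tauP F : triangle_family F ->
  (exists2 X, transversal_of F X & #|X| = tau F) /\
  (forall X, transversal_of F X -> tau F <= #|X|).
Proof.
rewrite /tau => /edge_set_transversal ET; case: arg_minnP => // X XT Xmin.
by split=> //; exists X.
Qed.

Lemma card_triangle_edges t : is_triangle t -> #|triangle_edges t| = 3.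
Proof.
case/andP=> /eqP t3 /forall_inP tadj.
have -> : triangle_edges t = [set a : {set G} | a \subset t & #|a| == 2].
  apply/setP=> a; rewrite !inE andbC; case at_: (a \subset t) => //=.
  apply/imsetP/cards2P=> [[[x y]]|[x [y [xy aE]]]].
    rewrite inE /= => xy ->; exists x, y; split=> //.
    by apply: contraTneq xy => ->; rewrite adj_irr.
  move: at_; rewrite aE subUset !sub1set => /andP[xt yt].
  exists (x, y) => //; rewrite inE /=.
  by have /forall_inP/(_ y yt)/implyP/(_ xy) := tadj x xt.
by rewrite cards_draws t3.
Qed.

End Triangles.

(* Main.v *)
Require Import Defs.
From mathcomp Require Import all_boot all_order all_algebra.
From mathcomp Require Import lra.
Set Implicit Arguments.
Unset Strict Implicit.
Unset Printing Implicit Defensive.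
Import Order.TTheory GRing.Theory Num.Theory.

(** Fix a colouring and write x = 1 + sqrt 3, the positive root of
    x^2 = 2 x + 2.  Let M be a maximum independent subfamily of F, of size nu,
    and let F' consist of the triangles of F that contain no blue edge of a
    member of M.  Two bounds on tau F are played against each other.

    - The 2 nu blue edges of M, together with a transversal of F', form a
      transversal of F, so tau F <= 2 nu + tau F'  ([tau_le_blue]).

    - Let M' be a maximum independent subfamily of F', of size nu'.  By
      maximality of M, each t' in M' shares an edge with a member of M; this
      edge is not blue, so it is the red edge of t' and of a unique member t
      of M, the mate of t'.  A mate can be exchanged for its partner without
      destroying independence, and this can be done for any set of partners
      at once.  Comparing a triangle s of F with several of the resulting
      maximum families shows that, if s has no edge in common with the
      unmated members of M and avoids all red edges of M', then s contains a
      blue edge of some t' in M' and one of its mate t.  As t and t' are two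
      triangles on the same red edge, s contains both apexes, hence the pair
      that they form.  Taking all edges of the unmated members of M, the red
      edges of M' and the pairs of apexes gives
      tau F <= 3 (nu - nu') + 2 nu' = 3 nu - nu'  ([tau_le_exchange]).

    By induction tau F' <= x nu', and eliminating nu' from the two bounds
    yields (1 + x) tau F <= (2 + 3 x) nu = (1 + x) x nu. *)

(** * Edges, packings and transversals *)

Section Packing.
Variable G : sgraph.
Implicit Types (e s t : {set G}) (F H M X : {set {set G}}).

Lemma card_edge e : e \in edge_set G -> #|e| = 2.
Proof.
case/imsetP=> -[x y]; rewrite inE /= => xy ->; rewrite cards2.
by case: eqVneq xy => // ->; rewrite adj_irr.
Qed.

Lemma triangle_pair s x y : is_triangle s -> x \in s -> y \in s -> x != y ->
  [set x; y] \in triangle_edges s.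
Proof.
case/andP=> _ /forall_inP adjs xs ys xy.
have /forall_inP/(_ y ys)/implyP/(_ xy) adjxy := adjs x xs.
rewrite inE subUset !sub1set xs ys !andbT.
by apply/imsetP; exists (x, y); rewrite ?inE.
Qed.

Lemma independent_eq H s t e : independent H -> s \in H -> t \in H ->
  e \in triangle_edges s -> e \in triangle_edges t -> s = t.
Proof.
move=> /forall_inP indH sH tH es et; have /forall_inP/(_ t tH) := indH s sH.
by case: eqVneq => //= _ /pred0P/(_ e); rewrite /= es et.
Qed.

Lemma nu_witness F : exists H, [/\ H \subset F, independent H & #|H| = nu F].
Proof.
have P0 : (set0 \subset F) && independent (set0 : {set {set G}}).
  by rewrite sub0set; apply/forall_inP => s; rewrite inE.
have [|H] := @eq_bigmax_cond _ [pred H : {set {set G}} |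
  (H \subset F) && independent H] (fun H => #|H|).
  by apply/card_gt0P; exists set0.
by rewrite inE => /andP[HF Hind] nuE; exists H; split; rewrite ?/nu ?nuE.
Qed.

Lemma leq_nu F H : H \subset F -> independent H -> (#|H| <= nu F).
Proof.
by move=> HF Hind; apply: leq_bigmax_cond; rewrite HF.
Qed.

(** Otherwise s could be added to H. *)
Lemma meets_maximum F H s : triangle_family F -> H \subset F ->
    independent H -> (nu F <= #|H|) -> s \in F ->
  exists t e, [/\ t \in H, e \in triangle_edges s & e \in triangle_edges t].
Proof.
move=> /forall_inP trF HF Hind Hmax sF.
have [sH|sH] := boolP (s \in H).
  have /card_gt0P[e es] : (0 < #|triangle_edges s|).
    by rewrite card_triangle_edges ?trF.
  by exists s, e.
have [/exists_inP[t tH]|] :=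
  boolP [exists t in H, ~~ [disjoint triangle_edges s & triangle_edges t]].
  by case/pred0Pn=> e /andP[es et]; exists t, e.
rewrite negb_exists_in => /forall_inP sdisj.
suff: (#|s |: H| <= nu F) by rewrite cardsU1 sH leqNgt ltnS Hmax.
apply: leq_nu; first by rewrite subUset sub1set sF HF.
apply/forall_inP=> u; rewrite !inE => uH; apply/forall_inP=> v; rewrite !inE => vH.
apply/implyP=> uv; case/predU1P: uH => [us|uH]; case/predU1P: vH => [vs|vH].
- by rewrite us vs eqxx in uv.
- by rewrite us; apply: negbNE; apply: sdisj.
- by rewrite vs disjoint_sym; apply: negbNE; apply: sdisj.
- by move/forall_inP: Hind => /(_ u uH)/forall_inP/(_ v vH)/implyP; apply.
Qed.

Lemma tau_witness F : triangle_family F ->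
  exists2 X : {set {set G}}, #|X| = tau F &
    forall t, t \in F -> exists2 a, a \in X & a \in triangle_edges t.
Proof.
case/tauP=> [[X /andP[_ /forall_inP XF] cX] _]; exists X => // t tF.
exact/exists_inP/XF.
Qed.

(** Non-edges may be left in X: they are discarded. *)
Lemma tau_le F X : triangle_family F ->
  (forall t, t \in F -> exists2 a, a \in X & a \in triangle_edges t) ->
  (tau F <= #|X|).
Proof.
move=> trF XF; apply: leq_trans (subset_leq_card (subsetIl X (edge_set G))).
apply: (tauP trF).2; rewrite /transversal_of subsetIr; apply/forall_inP=> t tF.
have [a aX at_] := XF t tF; apply/exists_inP; exists a => //.
by rewrite inE aX /=; move: at_; rewrite inE => /andP[].
Qed.

Lemma leq_card_bigcup (I T : finType) (A : {set I}) (f : I -> {set T}) n :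
  (forall i, i \in A -> #|f i| <= n) -> (#|\bigcup_(i in A) f i| <= n * #|A|).
Proof.
move=> fn; rewrite mulnC -sum_nat_const.
elim/big_rec2: _ => [|i B m iA IH]; first by rewrite cards0.
by rewrite (leq_trans (leq_card_setU _ _)) ?leq_add ?fn.
Qed.

End Packing.

(** * The two bounds on the transversal number *)

Section Colouring.
Variables (G : sgraph) (red : {set {set G}}).
Implicit Types (e s t u : {set G}) (F H M X : {set {set G}}).

Definition red_edges t := triangle_edges t :&: red.
Definition blue_edges t := triangle_edges t :&: (edge_set G :\: red).

Definition well_coloured F := forall t, t \in F ->
  [/\ is_triangle t, #|blue_edges t| = 2 & #|red_edges t| = 1].

Definition avoiding_blue F M :=
  [set t in F | [forall s in M, [disjoint blue_edges s & triangle_edges t]]].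

Lemma blueE t e : (e \in blue_edges t) = (e \in triangle_edges t) && (e \notin red).
Proof. by rewrite !inE; case: (e \in edge_set G); rewrite ?andbF ?andbT. Qed.

Lemma redE t e : (e \in red_edges t) = (e \in triangle_edges t) && (e \in red).
Proof. by rewrite inE. Qed.

Lemma triangle_family_wc F : well_coloured F -> triangle_family F.
Proof. by move=> wF; apply/forall_inP => t /wF[]. Qed.

Lemma red_edges_eq s t e : #|red_edges s| = 1 -> #|red_edges t| = 1 ->
  e \in red_edges s -> e \in red_edges t -> red_edges s = red_edges t.
Proof.
move=> /eqP/cards1P[a ->] /eqP/cards1P[b ->].
by rewrite !inE => /eqP-> /eqP->.
Qed.

Lemma avoiding_blue_sub F M : avoiding_blue F M \subset F.
Proof. by apply/subsetP => t; rewrite inE => /andP[]. Qed.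

Lemma avoiding_blueP F M s t e : t \in avoiding_blue F M -> s \in M ->
  e \in blue_edges s -> e \in triangle_edges t -> False.
Proof.
rewrite inE => /andP[_ /forall_inP tM] sM es et.
by have /pred0P/(_ e) := tM s sM; rewrite /= es et.
Qed.

Lemma tau_le_blue F M : well_coloured F -> M \subset F ->
  tau F <= 2 * #|M| + tau (avoiding_blue F M).
Proof.
move=> wF MF; have wF' : well_coloured (avoiding_blue F M).
  by move=> t /(subsetP (avoiding_blue_sub F M)) /wF.
have [X <- XF'] := tau_witness (triangle_family_wc wF').
set B := \bigcup_(t in M) blue_edges t.
have cB : #|B| <= 2 * #|M|.
  by apply: leq_card_bigcup => t /(subsetP MF)/wF[_ -> _].
apply: leq_trans (leq_trans (leq_card_setU B X) _); last by rewrite leq_add2r.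
apply: tau_le; first exact: triangle_family_wc.
move=> t tF; have [tF'|] := boolP (t \in avoiding_blue F M).
  by have [a aX at_] := XF' t tF'; exists a; rewrite // inE aX orbT.
rewrite inE tF /= negb_forall_in => /exists_inP[s sM /pred0Pn[a /andP[/= as_ at_]]].
by exists a => //; rewrite inE; apply/orP; left; apply/bigcupP; exists s.
Qed.

Section Exchange.
Variables (F M M' : {set {set G}}).
Hypotheses (wF : well_coloured F) (MF : M \subset F) (Mind : independent M).
Hypothesis Mmax : nu F <= #|M|.
Hypotheses (M'F : M' \subset avoiding_blue F M) (M'ind : independent M').

Let M'subF : M' \subset F := subset_trans M'F (avoiding_blue_sub F M).
Let trF : triangle_family F := triangle_family_wc wF.

Let avoid s t e : s \in M -> t \in M' ->
  e \in blue_edges s -> e \in triangle_edges t -> False.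
Proof. by move=> sM /(subsetP M'F) tF'; apply: avoiding_blueP tF' sM. Qed.

Lemma red_edges_inj H : H \subset F -> independent H -> {in H &, injective red_edges}.
Proof.
move=> HF Hind s t sH tH st.
have [_ _ /eqP/cards1P[e re]] := wF (subsetP HF s sH).
have er : e \in red_edges s by rewrite re set11.
apply: (independent_eq Hind sH tH (e := e)).
  by move: er; rewrite redE => /andP[].
by move: er; rewrite st redE => /andP[].
Qed.

(** Edge-disjointness between M and M' can only fail on red edges, because
    the members of M' avoid the blue edges of M; so triangles taken from both
    families are edge-disjoint as soon as their red edges are distinct. *)
Lemma independent_mix H : H \subset M :|: M' -> {in H &, injective red_edges} ->
  independent H.
Proof.
move=> HMM' Hinj; apply/forall_inP => s sH; apply/forall_inP => t tH.
apply/implyP => st; apply/pred0P => e /=; apply/negP => /andP[es et].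
have cross a b : a \in M -> b \in M' -> a \in H -> b \in H ->
    e \in triangle_edges a -> e \in triangle_edges b -> a = b.
  move=> aM bM' aH bH ea eb; have [er|eb'] := boolP (e \in red).
    apply: Hinj => //; apply: (@red_edges_eq _ _ e).
    - by have [] := wF (subsetP MF a aM).
    - by have [] := wF (subsetP M'subF b bM').
    - by rewrite redE ea.
    - by rewrite redE eb.
  by case: (avoid aM bM' (e := e)); rewrite // blueE ea.
have /setUP[sM|sM] := subsetP HMM' s sH; have /setUP[tM|tM] := subsetP HMM' t tH.
- by move/eqP: st; apply; apply: (independent_eq Mind sM tM es et).
- by move/eqP: st; apply; apply: cross.
- by move/eqP: st; apply; apply/esym/cross.
- by move/eqP: st; apply; apply: (independent_eq M'ind sM tM es et).
Qed.

Lemma mate_exists t' : t' \in M' -> exists2 t, t \in M & red_edges t = red_edges t'.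
Proof.
move=> tM'; have tF := subsetP M'subF t' tM'.
have [t [e [tM et' et]]] := meets_maximum trF MF Mind Mmax tF.
exists t => //; have [er|eb] := boolP (e \in red).
  apply: (@red_edges_eq _ _ e).
  - by have [] := wF (subsetP MF t tM).
  - by have [] := wF tF.
  - by rewrite redE et.
  - by rewrite redE et'.
by case: (avoid tM tM' (e := e)); rewrite // blueE et.
Qed.

(** The default value t' is never taken on M', by [mate_exists]. *)
Definition mate t' := odflt t' [pick t in M | red_edges t == red_edges t'].

Lemma mateP t' : t' \in M' -> mate t' \in M /\ red_edges (mate t') = red_edges t'.
Proof.
move=> tM'; rewrite /mate; case: pickP => [t /andP[tM /eqP] //|no].
by have [t tM rt] := mate_exists tM'; have := no t; rewrite /= tM rt eqxx.
Qed.

Lemma mate_inj : {in M' &, injective mate}.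
Proof.
move=> s t sM tM st; apply: (red_edges_inj M'subF M'ind) => //.
by rewrite -(mateP sM).2 st (mateP tM).2.
Qed.

Lemma M_disjoint_M' t : t \in M -> t \in M' -> False.
Proof.
move=> tM tM'; have [_ b2 _] := wF (subsetP MF t tM).
have /card_gt0P[e eb] : 0 < #|blue_edges t| by rewrite b2.
by apply: (avoid tM tM' eb); move: eb; rewrite blueE => /andP[].
Qed.

Definition unmated := M :\: mate @: M'.

Lemma card_unmated : #|unmated| + #|M'| = #|M|.
Proof.
have sub : mate @: M' \subset M by apply/subsetP => _ /imsetP[t tM ->]; case: (mateP tM).
by rewrite -(card_in_imset mate_inj) -(cardsID (mate @: M') M) (setIidPr sub) addnC.
Qed.

(** Exchanging every mate for its partner keeps the red edges distinct and
    does not change the number of triangles, so the result is again a maximum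
    independent subfamily. *)
Lemma meets_exchange_all s : s \in F -> exists t e,
  [/\ t \in unmated :|: M', e \in triangle_edges s & e \in triangle_edges t].
Proof.
have HMM' : unmated :|: M' \subset M :|: M' by rewrite setSU ?subsetDl.
apply: meets_maximum => //.
- by apply: subset_trans HMM' _; rewrite subUset MF.
- apply: independent_mix => // a b.
  have cross u v : u \in unmated -> v \in M' -> red_edges u = red_edges v -> u = v.
    rewrite inE => /andP[uN uM] vM' uv; case/negP: uN; apply/imsetP; exists v => //.
    have [mM mr] := mateP vM'.
    by apply: (red_edges_inj MF Mind) => //; rewrite mr.
  rewrite !in_setU => /orP[au|aM'] /orP[bu|bM'] ab.
  + by apply: (red_edges_inj MF Mind) => //; [case/setDP: au|case/setDP: bu].
  + exact: cross.
  + exact/esym/cross.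
  + exact: (red_edges_inj M'subF M'ind).
- apply: leq_trans Mmax _; rewrite cardsU -card_unmated.
  have -> : unmated :&: M' = set0; last by rewrite cards0 subn0.
  apply/setP => t; rewrite !inE; apply/negP => /andP[/andP[_ tM] tM'].
  exact: M_disjoint_M' tM tM'.
Qed.

(** The same exchange, performed for a single member of M'. *)
Lemma meets_exchange_one t' s : t' \in M' -> s \in F -> exists u e,
  [/\ u \in t' |: M :\ mate t', e \in triangle_edges s & e \in triangle_edges u].
Proof.
move=> tM'; have [mM mr] := mateP tM'.
apply: meets_maximum => //.
- by rewrite subUset sub1set (subsetP M'subF) //= (subset_trans (subD1set _ _)).
- apply: independent_mix.
    by rewrite subUset sub1set inE tM' orbT subsetU // subD1set.
  have cross u : u \in M :\ mate t' -> red_edges u = red_edges t' -> u = t'.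
    rewrite !inE => /andP[/eqP um uM] ur; case: um.
    by apply: (red_edges_inj MF Mind) => //; rewrite mr.
  move=> a b; rewrite !in_setU1 => /predU1P[->|au] /predU1P[->|bu] ab //.
  + exact/esym/cross.
  + exact: cross.
  + by apply: (red_edges_inj MF Mind) => //; [case/setD1P: au|case/setD1P: bu].
- apply: leq_trans Mmax _; rewrite cardsU1 (cardsD1 (mate t') M) mM leq_add2r.
  rewrite !inE; case: (boolP (t' \in M)) => [tM|]; last by rewrite andbF.
  by case: (M_disjoint_M' tM tM').
Qed.

(** The pair of apexes of two triangles with a common base. *)
Definition apexes t t' := (t :\: t') :|: (t' :\: t).

(** The base is the common red edge.  A blue edge of one of the triangles is an
    edge other than the base, so it contains the apex. *)
Lemma apexes_pair t t' : is_triangle t -> is_triangle t' -> t != t' ->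
    #|red_edges t| = 1 -> red_edges t = red_edges t' ->
  exists z z', [/\ apexes t t' = [set z; z'], z != z',
    forall e, e \in blue_edges t -> z \in e &
    forall e, e \in blue_edges t' -> z' \in e].
Proof.
move=> /andP[/eqP t3 _] /andP[/eqP t'3 _] tt' /eqP/cards1P[r rt] rr.
have [rE rsub rsub' rred] : [/\ r \in edge_set G, r \subset t, r \subset t' & r \in red].
  have : r \in red_edges t by rewrite rt set11.
  have : r \in red_edges t' by rewrite -rr rt set11.
  by rewrite !inE => /andP[/andP[_ ->] _] /andP[/andP[-> ->] ->].
have tI : t :&: t' = r.
  apply/esym/eqP; rewrite eqEcard subsetI rsub rsub' (card_edge rE) leqNgt /=.
  apply: contraNN tt' => I3; rewrite eqEcard t3 t'3 leqnn andbT; apply/setIidPl/eqP.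
  by rewrite eqEcard subsetIl t3.
have c1 : #|t :\: t'| = 1.
  by have := cardsID t' t; rewrite tI t3 (card_edge rE) add2n => -[].
have c1' : #|t' :\: t| = 1.
  by have := cardsID t t'; rewrite setIC tI t'3 (card_edge rE) add2n => -[].
have /eqP/cards1P[z zE] := c1; have /eqP/cards1P[z' z'E] := c1'.
have apex (a b : {set G}) y e : a :&: b = r ->
    a :\: b = [set y] -> e \in blue_edges a -> y \in e.
  move=> abI abD; rewrite blueE inE => /andP[/andP[eE ea] enr].
  apply: contraNT enr => ye; suff -> : e = r by [].
  apply/eqP; rewrite eqEcard (card_edge rE) (card_edge eE) leqnn andbT -abI subsetI ea.
  apply/subsetP => x xe; apply: contraNT ye => xb.
  have : x \in a :\: b by rewrite inE xb (subsetP ea).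
  by rewrite abD inE => /eqP <-.
exists z, z'; split.
- by rewrite /apexes zE z'E.
- have : z \in t :\: t' by rewrite zE set11.
  have : z' \in t' :\: t by rewrite z'E set11.
  rewrite !inE => /andP[_ z't'] /andP[zt' _].
  by apply: contraNneq zt' => ->.
- by move=> e; apply: apex zE.
- by move=> e; apply: apex z'E; rewrite setIC.
Qed.

Definition exchange_cover :=
  \bigcup_(t in unmated) triangle_edges t :|:
  \bigcup_(t' in M') (apexes (mate t') t' |: red_edges t').

Lemma card_exchange_cover : #|exchange_cover| <= 3 * #|unmated| + 2 * #|M'|.
Proof.
apply: leq_trans (leq_card_setU _ _) (leq_add _ _); apply: leq_card_bigcup => t.
  case/setDP=> tM _; rewrite card_triangle_edges //.
  by have [] := wF (subsetP MF t tM).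
move=> tM'; have [_ _ r1] := wF (subsetP M'subF t tM').
by rewrite cardsU1 r1 addn1 ltnS leq_b1.
Qed.

(** Suppose that s avoids the cover.  All its edges shared with M or M' are
    then blue.  It shares an edge e with some t in M; let t' be the partner of
    t.  Once t' replaces t, s must still meet the family, and the only way
    left is through a blue edge e2 of t'.  Now e contains the apex of t and e2
    that of t', so the pair of apexes is an edge of s in the cover. *)
Lemma exchange_coverP s : s \in F ->
  exists2 a, a \in exchange_cover & a \in triangle_edges s.
Proof.
move=> sF; have [/exists_inP[a aX as_]|] :=
  boolP [exists a in exchange_cover, a \in triangle_edges s]; first by exists a.
rewrite negb_exists_in => /forall_inP sX; exfalso.
have no_unmated t e : t \in unmated -> e \in triangle_edges t ->
    e \in triangle_edges s -> False.
  move=> tU et; apply/negP/sX; rewrite inE; apply/orP; left.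
  by apply/bigcupP; exists t.
have no_partner a t' : t' \in M' -> a \in apexes (mate t') t' |: red_edges t' ->
    a \in triangle_edges s -> False.
  move=> tM' a_; apply/negP/sX; rewrite inE; apply/orP; right.
  by apply/bigcupP; exists t'.
have blueM t' e : t' \in M' -> e \in triangle_edges t' -> e \in triangle_edges s ->
    e \in blue_edges t'.
  move=> tM' et es; rewrite blueE et; apply/negP => er.
  by apply: (no_partner e t' tM'); rewrite // in_setU1 redE et er orbT.
have meets_mate t e : t \in M -> e \in triangle_edges s -> e \in triangle_edges t ->
    exists t', [/\ t' \in M', t = mate t' & e \in blue_edges t].
  move=> tM es et; have [|tN] := boolP (t \in mate @: M'); last first.
    by case: (no_unmated t e); rewrite // inE tN.
  case/imsetP=> t' tM' tE; exists t'; split=> //; rewrite blueE et; apply/negP => er.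
  apply: (no_partner e t' tM'); rewrite // in_setU1 -(mateP tM').2 -tE redE et er.
  by rewrite orbT.
have [trs b2 _] := wF sF.
have blue_s t e : e \in blue_edges t -> e \in triangle_edges s -> e \in blue_edges s.
  by rewrite !blueE => /andP[_ ->] ->.
have [t [e [tM es et]]] := meets_maximum trF MF Mind Mmax sF.
have [t' [tM' tE eb]] := meets_mate t e tM es et.
have [u [e2 [uH e2s e2u]]] := meets_exchange_one tM' sF.
case/setU1P: uH => [ut'|/setD1P[ut uM]]; last first.
  (* Two blue edges of s lie in members of M; exchanging all mates at once
     would provide a third one. *)
  have [u' [uM' uE e2b]] := meets_mate u e2 uM e2s e2u.
  have [v [e3 [/setUP[vU|vM'] e3s e3v]]] := meets_exchange_all sF.
    exact: no_unmated vU e3v e3s.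
  have e3b := blueM v e3 vM' e3v e3s.
  have ee2 : e != e2.
    apply: contraNneq ut => ee2; rewrite -tE; apply/eqP.
    by apply: (independent_eq Mind uM tM e2u); rewrite -ee2.
  have ee3 : e != e3 by apply/eqP => ee3; apply: (avoid tM vM' eb); rewrite ee3.
  have e2e3 : e2 != e3 by apply/eqP => e23; apply: (avoid uM vM' e2b); rewrite e23.
  suff : 2 < #|blue_edges s| by rewrite b2.
  apply/card_gt2P; exists e, e2, e3; split; first split; rewrite 1?eq_sym //.
  - exact: blue_s eb es.
  - exact: blue_s e2b e2s.
  - exact: blue_s e3b e3s.
  - by split=> //; rewrite eq_sym.
rewrite {u}ut' in e2u; have e2b := blueM t' e2 tM' e2u e2s.
have [_ mr] := mateP tM'; rewrite -tE in mr.
have [trt _ r1] := wF (subsetP MF t tM).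
have [trt' _ _] := wF (subsetP M'subF t' tM').
have tt' : t != t' by apply/eqP => tt'; apply: (M_disjoint_M' tM); rewrite tt'.
have [z [z' [apE zz' ze ze']]] := apexes_pair trt trt' tt' r1 mr.
apply: (no_partner (apexes t t') t' tM'); first by rewrite -tE setU11.
have subs a : a \in triangle_edges s -> a \subset s by rewrite inE => /andP[].
rewrite apE; apply: triangle_pair => //.
  exact: (subsetP (subs e es)) (ze e eb).
exact: (subsetP (subs e2 e2s)) (ze' e2 e2b).
Qed.

Lemma tau_le_exchange : tau F + #|M'| <= 3 * #|M|.
Proof.
have tauX := leq_trans (tau_le trF exchange_coverP) card_exchange_cover.
rewrite -card_unmated mulnDr.
apply: leq_trans (leq_add tauX (leqnn _)) _.
by rewrite -addnA -{2}[#|M'|]mul1n -mulnDl.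
Qed.

End Exchange.

End Colouring.

(** * Combining the bounds *)

Local Open Scope ring_scope.

(** The weights 1 and x make the N' terms of the two bounds cancel; the total
    factor 1 + x is then removed, as 2 + 3 x = (1 + x) x. *)
Lemma eliminate_nu' (R : realFieldType) (x T N T' N' : R) :
    0 < x -> x * x = 2%:R * x + 2%:R ->
    T <= 2%:R * N + T' -> T' <= x * N' -> T + N' <= 3%:R * N ->
  T <= x * N.
Proof.
move=> x_gt0 xx TT' T'N' TN'.
have xTN' := ler_wpM2l (ltW x_gt0) TN'.
have x1_gt0 : 0 < 1 + x by rewrite addr_gt0.
rewrite -(ler_pM2l x1_gt0).
have -> : (1 + x) * (x * N) = x * N + (2%:R * x + 2%:R) * N.
  by rewrite mulrDl mul1r [x * (x * N)]mulrA xx.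
by lra.
Qed.

Theorem theorem1 (R : rcfType) (G : sgraph) (F : {set {set G}})
  (hF : triangle_family F) (hcol : two_colorable F) :
  (tau F)%:R <= (1 + Num.sqrt 3%:R) * (nu F)%:R :> R.
Proof.
case: hcol => red _ hred; set x : R := 1 + Num.sqrt 3%:R.
have x_gt0 : 0 < x by rewrite ltr_wpDr ?sqrtr_ge0.
have xx : x * x = 2%:R * x + 2%:R.
  have := @sqr_sqrtr R 3%:R (ler0n _ _); rewrite /x expr2; set q := Num.sqrt _ => qq.
  by lra.
have wF : well_coloured red F.
  by move=> t tF; split; [move/forall_inP: hF; apply|case: (hred t tF)..].
clear hF hred.
have [n] := ubnP #|F|; elim: n F wF => // n IH F wF; rewrite ltnS => Fn.
have [M [MF Mind Mnu]] := nu_witness F.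
have [M' [M'F M'ind M'nu]] := nu_witness (avoiding_blue red F M).
have blue := tau_le_blue wF MF.
have Mmax : (nu F <= #|M|)%N by rewrite Mnu.
have := tau_le_exchange wF MF Mind Mmax M'F M'ind.
rewrite M'nu Mnu -(ler_nat R) natrD natrM => exch.
rewrite Mnu -(ler_nat R) natrD natrM in blue.
have [M0|[t tM]] := set_0Vmem M.
  have nu0 : nu F = 0%N by rewrite -Mnu M0 cards0.
  by rewrite nu0 mulr0 in exch *; have := ler0n R (nu (avoiding_blue red F M)); lra.
have F'F : (#|avoiding_blue red F M| < #|F|)%N.
  have [_ b2 _] := wF t (subsetP MF t tM).
  have /card_gt0P[e eb] : (0 < #|blue_edges red t|)%N by rewrite b2.
  apply: proper_card; rewrite properE avoiding_blue_sub.
  apply/subsetPn; exists t; first exact: (subsetP MF).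
  apply/negP => tF'; apply: (avoiding_blueP tF' tM eb).
  by move: eb; rewrite blueE => /andP[].
have wF' : well_coloured red (avoiding_blue red F M).
  by move=> s /(subsetP (avoiding_blue_sub red F M)) /wF.
have := IH _ wF' (leq_trans F'F Fn) => ind.
exact: (eliminate_nu' x_gt0 xx blue ind exch).
Qed.
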